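(* Let $\tau$ be an infinite cardinal number, $(A,\rho,\mathbb{B})$ be an LCA and $X=\Psi^a(A,\rho,\mathbb{B})$. Then $w(X)=\tau$ if and only if $w(A,\rho,\mathbb{B})=\tau$.
   Context: Boolean algebras may be degenerate ($0=1$ allowed); the complement of $a$ is written $a^*$. $w(X)$ denotes the topological weight of $X$. A contact relation on a Boolean algebra $A$ is a binary relation $\rho$ such that: $a\neq 0$ implies $a\rho a$; $a\rho b$ implies $a\ne 0$ and $b\neq 0$; $a\rho b$ implies $b\rho a$; $a\rho(b\vee c)$ iff ($a\rho b$ or $a\rho c$). Write $a\ll_\rho b$ iff not $a\,\rho\, b^*$. A local contact algebra (LCA) is a triple $(A,\rho,\mathbb{B})$ where $A$ is a Boolean algebra, $\rho$ is a contact relation on $A$ and $\mathbb{B}$ is an ideal of $A$ (possibly $\mathbb B=A$) such that (BC1) if $a\in\mathbb{B}$, $c\in A$ and $a\ll_\rho c$ then $a\ll_\rho b\ll_\rho c$ for some $b\in\mathbb{B}$; (BC2) if $a\rho b$ then there is $c\in\mathbb{B}$ with $a\rho(c\wedge b)$; (BC3) if $a\neq 0$ then there is $b\in\mathbb{B}\setminus\{0\}$ with $b\ll_\rho a$. For an LCA $(A,\rho,\mathbb{B})$, define the relation $C_\rho$ on $A$ by: $a\,C_\rho\, b$ iff $a\rho b$ or ($a\notin\mathbb{B}$ and $b\notin\mathbb{B}$). A cluster in $(A,C_\rho)$ is a non-empty $\sigma\subseteq A$ such that: $a,b\in\sigma$ implies $aC_\rho b$; $a\vee b\in\sigma$ implies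 $a\in\sigma$ or $b\in\sigma$; if $aC_\rho b$ for every $b\in\sigma$ then $a\in\sigma$. A bounded cluster of $(A,\rho,\mathbb{B})$ is a cluster $\sigma$ in $(A,C_\rho)$ with $\sigma\cap\mathbb{B}\neq\emptyset$. $\Psi^a(A,\rho,\mathbb{B})$ is the set of all bounded clusters of $(A,\rho,\mathbb{B})$ with the topology having the family $\{\lambda_A^g(a)\mid a\in A\}$ as a base of closed sets, where $\lambda_A^g(a)=\{\sigma\mid a\in\sigma\}$; it is a locally compact Hausdorff space. A subset $\mathcal{B}$ of $\mathbb{B}$ is a base of $(A,\rho,\mathbb{B})$ if for all $a,c\in\mathbb{B}$ with $a\ll_\rho c$ there is $b\in\mathcal{B}$ with $a\le b\le c$. The weight is $w(A,\rho,\mathbb{B})=\min\{|\mathcal{B}|\mid\mathcal{B}\text{ is a base of }(A,\rho,\mathbb{B})\}$. *)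

(* Defs.v *)
From HB Require Import structures.
From mathcomp Require Import all_boot all_order.
From mathcomp Require Import boolp classical_sets functions cardinality.
From mathcomp Require Import topology_structure.

Set Implicit Arguments.
Unset Strict Implicit.
Unset Printing Implicit Defensive.

Import Order.TTheory.
Local Open Scope order_scope.

(* Boolean algebras are [ctbDistrLatticeType]s; \bot = \top is not excluded. *)

Section Contact.
Context {d : Order.disp_t} {A : ctbDistrLatticeType d}.
Implicit Types (rho : A -> A -> Prop) (I sigma : set A) (a b c : A).

Record contact_relation rho : Prop := ContactRelation {
  contact_refl : forall a, a != \bot -> rho a a;
  contact_neq0 : forall a b, rho a b -> a != \bot /\ b != \bot;
  contact_sym : forall a b, rho a b -> rho b a;
  contact_join : forall a b c, rho a (b `|` c) <-> rho a b \/ rho a c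
}.

Definition well_inside rho a b : Prop := ~ rho a (~` b).

Record ideal I : Prop := Ideal {
  ideal_bot : I \bot;
  ideal_le : forall a b, a <= b -> I b -> I a;
  ideal_join : forall a b, I a -> I b -> I (a `|` b)
}.

Record cluster rho sigma : Prop := Cluster {
  cluster_nonempty : exists a, sigma a;
  cluster_contact : forall a b, sigma a -> sigma b -> rho a b;
  cluster_prime : forall a b, sigma (a `|` b) -> sigma a \/ sigma b;
  cluster_max : forall a, (forall b, sigma b -> rho a b) -> sigma a
}.

End Contact.

Record lca (d : Order.disp_t) (A : ctbDistrLatticeType d) := Lca {
  lca_rel : A -> A -> Prop;
  lca_bounded : set A;
  lca_contact : contact_relation lca_rel;
  lca_ideal : ideal lca_bounded;
  lca_BC1 : forall a c, lca_bounded a -> well_inside lca_rel a c ->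
    exists b, [/\ lca_bounded b, well_inside lca_rel a b
                & well_inside lca_rel b c];
  lca_BC2 : forall a b, lca_rel a b ->
    exists c, lca_bounded c /\ lca_rel a (c `&` b);
  lca_BC3 : forall a, a != \bot ->
    exists b, [/\ lca_bounded b, b != \bot & well_inside lca_rel b a]
}.

Section LCA.
Context {d : Order.disp_t} {A : ctbDistrLatticeType d}.
Variable L : lca A.
Implicit Types (a b c : A) (sigma : set A).

Definition lca_C a b : Prop :=
  lca_rel L a b \/ (~ lca_bounded L a /\ ~ lca_bounded L b).

Definition bounded_cluster sigma : Prop :=
  cluster lca_C sigma /\ exists a, sigma a /\ lca_bounded L a.

Definition lca_base (B : set A) : Prop :=
  (B `<=` lca_bounded L)%classic /\
  forall a c, lca_bounded L a -> lca_bounded L c ->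
    well_inside (lca_rel L) a c -> exists b, [/\ B b, a <= b & b <= c].

End LCA.

(* The set of bounded clusters, carrying the topology given below. *)
Definition Psi (d : Order.disp_t) (A : ctbDistrLatticeType d) (L : lca A) :
  Type := {sigma : set A | bounded_cluster L sigma}.

Section DualSpace.
Context {d : Order.disp_t} {A : ctbDistrLatticeType d}.
Variable L : lca A.
Implicit Types (a b c : A).
Local Open Scope classical_set_scope.

Definition lambda a : set (Psi L) := [set sigma | sval sigma a].

Lemma lambda_bot : lambda \bot = set0.
Proof.
apply/seteqP; split=> // -[sigma [csigma bsigma]] /= s0.
case: (cluster_contact csigma s0 s0) => [|[nb0 _]].
  by move=> /(contact_neq0 (lca_contact L))[]; rewrite eqxx.
exact: nb0 (ideal_bot (lca_ideal L)).
Qed.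

Lemma lca_C_le a b c : (a <= b)%O -> lca_C L a c -> lca_C L b c.
Proof.
move=> ab [ac|[na nc]]; [left|right].
- have rC := lca_contact L.
  apply: (contact_sym rC); rewrite -(join_idPr ab).
  by apply/(contact_join rC); left; apply: (contact_sym rC).
- by split=> // nb; apply: na; apply: (ideal_le (lca_ideal L) ab).
Qed.

Lemma lambda_join a b : lambda (a `|` b)%O = lambda a `|` lambda b.
Proof.
apply/seteqP; split=> -[sigma [csigma bsigma]] /=.
  exact: (cluster_prime csigma).
case=> s; apply: (cluster_max csigma) => e se.
  exact: lca_C_le (leUl a b) (cluster_contact csigma s se).
exact: lca_C_le (leUr b a) (cluster_contact csigma s se).
Qed.

Definition lambda_open : set (set (Psi L)) := range (fun a => ~` lambda a).

Lemma lambda_open_cover : \bigcup_(U in lambda_open) U = setT.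
Proof.
apply/seteqP; split=> // s _; exists (~` lambda \bot%O); first by exists \bot%O.
by rewrite lambda_bot.
Qed.

Lemma lambda_open_join (U V : set (Psi L)) s :
  lambda_open U -> lambda_open V -> U s -> V s ->
  exists W, [/\ lambda_open W, W s & W `<=` U `&` V].
Proof.
move=> [a _ <-] [b _ <-] sa sb; exists (~` lambda (a `|` b)%O); split.
- by exists (a `|` b)%O.
- by rewrite lambda_join => -[].
- by rewrite lambda_join setCU.
Qed.

HB.instance Definition _ := gen_eqMixin (Psi L).
HB.instance Definition _ := gen_choiceMixin (Psi L).
HB.instance Definition _ :=
  isBaseTopological.Build (Psi L) lambda_open_cover lambda_open_join.

(* The sets [lambda a] form a base of closed sets. *)
Lemma closed_PsiP (F : set (Psi L)) :
  closed F <-> exists S : set A, F = \bigcap_(a in S) lambda a.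
Proof.
rewrite -openC; split.
- move=> [D DS FE]; exists [set a | D (~` lambda a)].
  rewrite -[LHS]setCK -FE setC_bigcup; apply/seteqP; split=> s sF U.
    by move=> /sF; apply: contrapT.
  by move=> DU; have [a _ aU] := DS _ DU; subst U; move=> /(_ (sF a DU)).
- move=> [S ->]; rewrite setC_bigcap.
  by apply: bigcup_open => a _; exists [set ~` lambda a];
    [move=> _ ->; exists a | rewrite bigcup_set1].
Qed.

End DualSpace.

Section Weight.
Local Open Scope classical_set_scope.
Local Open Scope card_scope.

(* A cardinal number is given by a set [K] having that cardinality; [min_card]
   says that the least cardinality of a member of [F] is that of [K]. *)
Definition min_card (U T : Type) (F : set (set U)) (K : set T) : Prop :=
  (exists B, F B /\ B #= K) /\ (forall B, F B -> K #<= B).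

Definition weight_is (X : topologicalType) (T : Type) (K : set T) : Prop :=
  min_card (@basis X) K.

Definition lca_weight_is (d : Order.disp_t) (A : ctbDistrLatticeType d)
    (L : lca A) (T : Type) (K : set T) : Prop :=
  min_card (lca_base L) K.

End Weight.

(* Main.v *)
Require Import Defs.
From mathcomp Require Import all_boot all_order.
From mathcomp Require Import boolp classical_sets functions cardinality.
From mathcomp Require Import topology_structure.

(** A base [B] of the algebra gives the base [{~ lambda (b^* )}] of the space.
    Conversely, let [B] be a base of the space.  If [a << b << c] are bounded,
    then compactness of [lambda a] and [lambda b] yields finite unions [V], [W]
    of members of [B] with [lambda a <= V <= lambda b <= W <= lambda c]; choosing
    for each such pair one bounded element in between gives a base of the algebra,
    because [lambda] reflects the order.  There are at most [|B|] pairs of finite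
    unions when [B] is infinite, and finitely many when [B] is finite. *)

Set Implicit Arguments.
Unset Strict Implicit.
Unset Printing Implicit Defensive.

Import Order.Theory.
Local Open Scope order_scope.
Local Open Scope classical_set_scope.

(** * Cardinal arithmetic of infinite sets: comparability, finite sequences, pairs of finite
    unions *)

Section Cardinals.
Local Open Scope card_scope.

Definition inj_into (T U : Type) (A : set T) (B : set U) (f : T -> U) :=
  (forall x, A x -> B (f x)) /\
  (forall x y, A x -> A y -> f x = f y -> x = y).

Lemma inj_into_card_le (T U : Type) (A : set T) (B : set U) f :
  inj_into A B f -> A #<= B.
Proof.
move=> [fAB finj].
suff /injfunPex[g] : exists2 f : T -> U, set_fun A B f & set_inj A f.
  exact: inj_card_le.
by exists f => // x y /set_mem Ax /set_mem Ay; exact: finj.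
Qed.

Lemma card_le_inj_into (T U : Type) (A : set T) (B : set U) (u0 : U) :
  A #<= B -> exists f, inj_into A B f.
Proof.
elim/Ppointed: U => U in B u0 *; first by case: (no u0).
move=> /pcard_leP/injfunPex[f fAB finj]; exists f; split=> // x y Ax Ay.
by apply: finj; exact/mem_set.
Qed.

Lemma card_le_total (T U : Type) (A : set T) (B : set U) : A #<= B \/ B #<= A.
Proof.
(* [P] describes the graphs of partial injections from [A] to [B]; a maximal one is total or
   onto. *)
pose P (G : set (T * U)) := G `<=` A `*` B /\
  forall p q, G p -> G q -> (p.1 = q.1 <-> p.2 = q.2).
have [F FP totF|G [[GAB Ginj] maxG]] := @Zorn_bigcup _ P.
  split=> [p [G FG]|p q [G FG Gp] [H FH Hq]]; first exact: (FP _ FG).1.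
  by case: (totF _ _ FG FH) => GH; [apply: (FP _ FH).2 | apply: (FP _ FG).2];
    rewrite //; exact: GH.
have [domG|/existsNP[a /not_implyP[Aa na]]] :=
    pselect (forall a, A a -> exists b, G (a, b)).
  left; have [->|/set0P[a0 /domG[b0 _]]] := eqVneq A set0; first exact: card_ge0.
  have /choice[f fP] a : exists b, A a -> G (a, b).
    by have [/domG[b]|] := pselect (A a); [exists b|exists b0].
  apply: (@inj_into_card_le _ _ _ _ f); split=> [a /fP/GAB[]//|a b /fP Ga /fP Gb].
  by move/(Ginj _ _ Ga Gb).
have [codG|/existsNP[b /not_implyP[Bb nb]]] :=
    pselect (forall b, B b -> exists a, G (a, b)).
  right; have /choice[f fP] b : exists a, B b -> G (a, b).
    by have [/codG[a']|] := pselect (B b); [exists a'|exists a].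
  apply: (@inj_into_card_le _ _ _ _ f); split=> [c /fP/GAB[]//|c e /fP Gc /fP Ge].
  by move/(Ginj _ _ Gc Ge).
(* Since [a] is outside the domain and [b] outside the range, adjoining [(a, b)] keeps the graph a
   partial injection, against maximality. *)
case: (maxG (G `|` [set (a, b)])).
  rewrite properEneq; split; last by move=> ?; left.
  by apply/eqP => GE; apply: na; exists b; rewrite GE; right.
split=> [p [/GAB//|->//]|[x y] [x' y'] [Gp|[-> ->]] [Gq|[-> ->]] //=].
- exact: (Ginj _ _ Gp Gq).
- by split=> E; rewrite E in Gp; [case: na; exists y|case: nb; exists x].
- by split=> E; rewrite -E in Gq; [case: na; exists y'|case: nb; exists x'].
Qed.

Definition seqs (T : eqType) (Y : set T) : set (seq T) :=
  [set s | [set` s] `<=` Y].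

Lemma seqs_map (T U : eqType) (Y : set T) (Z : set U) (e : T -> U) :
  inj_into Y Z e -> inj_into (seqs Y) (seqs Z) (map e).
Proof.
move=> [eYZ einj]; split=> [s sY z /= /mapP[x xs ->]|]; first exact/eYZ/sY.
elim=> [|x s IHs] [|y t] //= sY tY [xy st]; congr cons.
  by apply: einj xy; [apply: sY|apply: tY]; rewrite /= mem_head.
by apply: IHs st => z zs; [apply: sY|apply: tY]; rewrite /= inE zs orbT.
Qed.

Lemma inj_into_comp (T U V : Type) (A : set T) (B : set U) (C : set V) f g :
  inj_into A B f -> inj_into B C g -> inj_into A C (g \o f).
Proof.
move=> [fAB finj] [gBC ginj]; split=> [x /fAB/gBC//|x y Ax Ay /= E].
by apply: finj => //; apply: ginj E; exact: fAB.
Qed.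

(** A point [y] of [Y] is coded by [f [:: y]] and a point [w] of [W] outside [Y] by [f
    [:: phi w; phi w]]. The lengths 1 and 2 keep both kinds of codes apart, and a sequence of codes
    is again a sequence over [Y], to which [f] applies. *)
Lemma seqs_setU (T : eqType) (Y W : set T) f :
  inj_into (seqs Y) Y f -> W #<= Y -> exists g, inj_into (seqs (Y `|` W)) Y g.
Proof.
move=> [fY finj] /(card_le_inj_into (f [::]))[phi [phiY phinj]].
pose e x := if `[< Y x >] then f [:: x] else f [:: phi x; phi x].
suff eP : inj_into (Y `|` W) Y e.
  by exists (f \o map e); exact: inj_into_comp (seqs_map eP) _.
have s1 x : Y x -> seqs Y [:: x] by move=> Yx y /=; rewrite inE => /eqP->.
have s2 x : Y x -> seqs Y [:: x; x].
  by move=> Yx y /=; rewrite !inE orbb => /eqP->.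
have YW x : (Y `|` W) x -> ~ Y x -> Y (phi x) by move=> [//|/phiY].
rewrite /e; split=> [x YWx|x y YWx YWy].
  by case: asboolP => [/s1/fY//|/(YW _ YWx)/s2/fY].
case: asboolP => Yx; case: asboolP => Yy E.
- by have [] := finj _ _ (s1 _ Yx) (s1 _ Yy) E.
- by have := finj _ _ (s1 _ Yx) (s2 _ (YW _ YWy Yy)) E.
- by have := finj _ _ (s2 _ (YW _ YWx Yx)) (s1 _ Yy) E.
- have [+ _] := finj _ _ (s2 _ (YW _ YWx Yx)) (s2 _ (YW _ YWy Yy)) E.
  by apply: phinj; [case: YWx|case: YWy].
Qed.

(** The starting point for Zorn's lemma: on a countably infinite subset of [K], finite sequences are
    numbered through their indices by [pickle]. *)
Lemma exists_seqs_inj_into (T : eqType) (K : set T) : infinite_set K ->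
  exists Y f, Y `<=` K /\ inj_into (seqs Y) Y f.
Proof.
move=> Kinf; have [x0 _] := infinite_setN0 Kinf.
have /(card_le_inj_into x0)[i [iK iinj]] := (infiniteP K).1 Kinf.
have /choice[j jP] x : exists n, range i x -> i n = x.
  by have [[n _ <-]|] := pselect (range i x); [exists n|exists 0].
exists (range i), (fun s => i (pickle (map j s))).
split=> [_ [n _ <-]|]; first exact: iK.
have jinj : inj_into (range i) setT j.
  by split=> // x y /jP xE /jP yE E; rewrite -xE E.
split=> [s _|s t sY tY E]; first by exists (pickle (map j s)).
apply: (seqs_map jinj).2 => //; apply: (pcan_inj pickleK); exact: iinj E.
Qed.

(* Zorn's lemma on pairs [(Y, f)] with [f] an injection of the finite sequences
   over [Y] into [Y]: [Y] can be enlarged by a disjoint copy of itself, so a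
   maximal [Y] has the cardinality of [K]. *)
Theorem card_le_seqs (T : eqType) (K : set T) : infinite_set K -> seqs K #<= K.
Proof.
move=> Kinf.
pose S := {p : set T * (seq T -> T) | p.1 `<=` K /\ inj_into (seqs p.1) p.1 p.2}.
pose R (p q : S) := `[< (sval p).1 `<=` (sval q).1 /\
  forall s, seqs (sval p).1 s -> (sval p).2 s = (sval q).2 s >].
have RP p q : reflect ((sval p).1 `<=` (sval q).1 /\
  forall s, seqs (sval p).1 s -> (sval p).2 s = (sval q).2 s) (R p q) by exact: asboolP.
have [Y0 [f0 Yf0]] := exists_seqs_inj_into Kinf.
have [p|p q r /RP[pq pqE] /RP[qr qrE]|F totF|] :=
    @ZL_preorder S (exist _ (Y0, f0) Yf0) R.
- by apply/RP; split=> x.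
- apply/RP; split=> [x /pq/qr//|s sp]; rewrite pqE // qrE //.
  by move=> x /sp/pq.
- have [->|/set0P[p0 Fp0]] := eqVneq F set0; first by exists (exist _ (Y0, f0) Yf0).
  pose Y := \bigcup_(p in F) (sval p).1.
  (* A finite sequence over the union of a chain already lies over one member, so the injections of
     the members glue. *)
  have key s : seqs Y s -> exists2 p, F p & seqs (sval p).1 s.
    elim: s => [|x s IHs] sY; first by exists p0.
    have [|p Fp sp] := IHs; first by move=> z zs; apply: sY; rewrite /= inE zs orbT.
    have [q Fq qx] : Y x by apply: sY; rewrite /= mem_head.
    case: (totF _ _ Fp Fq) => /RP[sub _]; [exists q|exists p] => // z /=;
      rewrite inE => /predU1P[->|/sp] //; exact: sub.
  have /choice[f fP] s : exists y, forall p, F p -> seqs (sval p).1 s -> y = (sval p).2 s.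
    have [[p [Fp sp]]|nex] := pselect (exists p, F p /\ seqs (sval p).1 s).
      exists ((sval p).2 s) => q Fq sq.
      by case: (totF _ _ Fp Fq) => /RP[_ E]; rewrite E.
    by exists (f0 s) => p Fp sp; case: nex; exists p.
  have YfP : Y `<=` K /\ inj_into (seqs Y) Y f.
    split=> [x [p Fp]|]; first exact: (svalP p).1.
    split=> [s /key[p Fp sp]|s t sY tY].
      by exists p => //; rewrite (fP _ _ Fp sp); exact: (svalP p).2.1.
    (* Concatenation places [s] and [t] over the same member, whose injectivity then applies. *)
    have [|p Fp stp] := key (s ++ t).
      by move=> x /=; rewrite mem_cat => /orP[/sY|/tY].
    have sp : seqs (sval p).1 s by move=> x xs; apply: stp; rewrite /= mem_cat xs.
    have tp : seqs (sval p).1 t by move=> x xt; apply: stp; rewrite /= mem_cat xt orbT.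
    by rewrite (fP _ _ Fp sp) (fP _ _ Fp tp); exact: (svalP p).2.2.
  exists (exist _ (Y, f) YfP) => p Fp; apply/RP; split=> [x px|s sp] /=.
    by exists p.
  by rewrite (fP _ _ Fp sp).
move=> [[Y f] /= [YK Yf]] maxY.
have [KY|] := card_le_total (K `\` Y) Y.
  have [g gP] := seqs_setU Yf KY; apply: (@inj_into_card_le _ _ _ _ g).
  rewrite setDUK // in gP.
  by have [gY ginj] := gP; split=> // s /gY/YK.
move=> /(card_le_inj_into (f [::]))[psi [psiK psinj]].
have [g [gY ginj]] := seqs_setU Yf (card_image_le psi Y).
pose f' s := if `[< seqs Y s >] then f s else psi (g s).
have Yf' : Y `|` psi @` Y `<=` K /\ inj_into (seqs (Y `|` psi @` Y)) (Y `|` psi @` Y) f'.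
  have [fY finj] := Yf.
  split=> [x [/YK//|[y /psiK[Kx _] <-//]]|].
  rewrite /f'; split=> [s sY|s t sY tY].
    case: asboolP => [/fY|_]; first by left.
    by right; exists (g s) => //; exact: gY.
  case: asboolP => Ys; case: asboolP => Yt E.
  - exact: finj E.
  - by have [_ []] := psiK _ (gY _ tY); rewrite -E; exact: fY.
  - by have [_ []] := psiK _ (gY _ sY); rewrite E; exact: fY.
  - by apply: ginj => //; apply: psinj E; exact: gY.
have /maxY/RP[/= sub _] : R (exist _ (Y, f) (conj YK Yf)) (exist _ (_, f') Yf').
  apply/RP; split=> [x|s Ys] /=; first by left.
  by rewrite /f' asboolT.
have Yf0' : Y (f [::]) by apply: Yf.1.
by have [_ []] := psiK _ Yf0'; apply: sub; right; exists (f [::]).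
Qed.

Definition finite_unions (T : Type) (B : set (set T)) : set (set T) :=
  [set \bigcup_(V in [set` s]) V | s in seqs B].

Lemma finite_finite_unions (T : Type) (B : set (set T)) :
  finite_set B -> finite_set (finite_unions B).
Proof.
move=> /finite_seqP[r ->].
(* Only the set of members of a sequence matters to its union, so the boolean masks on [r] yield all
   finite unions. *)
pose U (m : (size r).-tuple bool) := \bigcup_(V in [set` mask m r]) V.
apply: (@sub_finite_set _ _ (range U)); last exact/finite_image/finite_finset.
move=> _ [s sr <-]; exists [tuple of map (mem s) (in_tuple r)] => //.
rewrite /U -filter_mask; congr bigcup; apply/seteqP; split=> V /=.
  by rewrite mem_filter => /andP[].
by move=> Vs; rewrite mem_filter; apply/andP; split=> //; exact: sr.
Qed.

Lemma card_le_setX (T : choiceType) (K : set T) : infinite_set K -> K `*` K #<= K.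
Proof.
move=> /card_le_seqs; apply: card_le_trans.
apply: (@inj_into_card_le _ _ _ _ (fun p => [:: p.1; p.2])); split.
  by move=> [x y] [/= Kx Ky] z /=; rewrite !inE => /orP[] /eqP->.
by move=> [x y] [x' y'] _ _ [-> ->].
Qed.

Lemma card_finite_unionsX (T : Type) (B : set (set T)) : infinite_set B ->
  finite_unions B `*` finite_unions B #<= B.
Proof.
(* The bound on squares applies to an infinite set only; the square of a finite one is countable,
   hence below [B]. *)
move=> Binf; have [finU|infU] := pselect (finite_set (finite_unions B)).
  apply: card_le_trans ((infiniteP B).1 Binf).
  exact/finite_set_countable/finite_setX.
apply: card_le_trans (card_le_setX infU) _.
exact: card_le_trans (card_image_le _ _) (card_le_seqs Binf).
Qed.

End Cardinals.

(** * Ultrafilters of a Boolean algebra *)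

Section Ultrafilter.
Context {d : Order.disp_t} {A : ctbDistrLatticeType d}.
Implicit Types (a b x : A) (u : set A) (s : seq A).

Record ultrafilter u : Prop := Ultrafilter {
  ultra_bot : ~ u \bot%O;
  ultra_le : forall a b, (a <= b)%O -> u a -> u b;
  ultra_meet : forall a b, u a -> u b -> u (a `&` b)%O;
  ultra_compl : forall a, u a \/ u (~` a)%O
}.

Definition finite_meets u :=
  forall s, [set` s] `<=` u -> (\meet_(x <- s) x)%O <> \bot%O.

Lemma ultrafilter_ext F : finite_meets F -> exists2 u, ultrafilter u & F `<=` u.
Proof.
(* [F] is joined inside [P] so that the union of the empty chain also satisfies [P]. *)
move=> Ffm; pose P G := finite_meets (F `|` G).
have [Fs FsP totF|G [PG maxG]] := @Zorn_bigcup A P.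
  suff key s : [set` s] `<=` F `|` \bigcup_(G in Fs) G ->
      [set` s] `<=` F \/ exists2 G, Fs G & [set` s] `<=` F `|` G.
    by move=> s /key[/Ffm|[G /FsP PG /PG]].
  elim: s => [|a s IHs] sub; first by left.
  have {}IHs : [set` s] `<=` F \/ exists2 G, Fs G & [set` s] `<=` F `|` G.
    by apply: IHs => x xs; apply: sub; rewrite /= inE xs orbT.
  have consP (E : set A) : E a -> [set` s] `<=` E -> [set` a :: s] `<=` E.
    by move=> Ea sE x /=; rewrite inE => /predU1P[->//|/sE].
  case: (sub a) => [|Fa|[G FG Ga]]; first by rewrite /= mem_head.
    case: IHs => [sF|[G FG sG]]; first by left; exact: consP.
    by right; exists G => //; apply: consP => //; left.
  right; case: IHs => [sF|[H FH sH]].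
    by exists G => //; apply: consP; [right|move=> x /sF; left].
  case: (totF _ _ FG FH) => GH.
    by exists H => //; apply: consP => //; right; apply: GH.
  exists G => //; apply: consP; first by right.
  by move=> x /sH[Fx|/GH Gx]; [left|right].
pose u := F `|` G.
(* By maximality, an element outside [u] is disjoint from some finite meet of elements of [u]; the
   filter axioms and the dichotomy follow from this. *)
have uP x : u x \/ exists2 s, [set` s] `<=` u & (\meet_(y <- s) y `&` x)%O = \bot%O.
  have [ux|nux] := pselect (u x); [by left|right].
  have nP : ~ P (G `|` [set x]).
    apply: maxG; rewrite properEneq; split; last by move=> y; left.
    by apply/eqP => /= GE; apply: nux; right; rewrite GE; right.
  have [s [sub ms]] : exists s, [set` s] `<=` F `|` (G `|` [set x]) /\
      (\meet_(y <- s) y)%O = \bot%O.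
    apply: contrapT => nex; apply: nP => s sub ms; apply: nex.
    by exists s.
  exists [seq y <- s | y != x].
    move=> y /=; rewrite mem_filter => /andP[/eqP yx /sub[Fy|[Gy|//]]].
      by left.
    by right.
  apply/eqP; rewrite -lex0 -ms; apply/meetsP_seq => y ys _.
  have [->|yx] := eqVneq y x; first exact: leIr.
  apply: le_trans (leIl _ _) _; apply: meets_inf_seq => //.
  by rewrite mem_filter yx.
have catP s t : [set` s] `<=` u -> [set` t] `<=` u -> [set` s ++ t] `<=` u.
  by move=> su tu x /=; rewrite mem_cat => /orP[/su|/tu].
have oneP x : u x -> [set` [:: x]] `<=` u by move=> ux y /=; rewrite inE => /eqP->.
exists u; last by move=> x; left.
split.
- by move=> /oneP/PG; rewrite big_seq1.
- move=> a b ab ua; have [//|[s su sb]] := uP b.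
  have [] := PG _ (catP _ _ su (oneP _ ua)); rewrite big_cat big_seq1 /=.
  by apply/eqP; rewrite -lex0 -sb leI2.
- move=> a b ua ub; have [//|[s su sb]] := uP (a `&` b)%O.
  have [] := PG _ (catP _ _ su (catP _ _ (oneP _ ua) (oneP _ ub))).
  by rewrite !big_cat !big_seq1.
- move=> a; have [|[s su sa]] := uP a; first by left.
  have [|[t tu ta]] := uP (~` a)%O; first by right.
  have [] := PG _ (catP _ _ su tu); rewrite big_cat /=.
  move/eqP: sa; move/eqP: ta; rewrite !disj_leC complK => ta sa.
  by apply/eqP; rewrite -lex0 (le_trans (leI2 sa ta))// meetC meetxC.
Qed.

End Ultrafilter.

Lemma basisE (X : topologicalType) (B : set (set X)) : basis B <->
  B `<=` open /\ forall U x, open U -> U x -> exists V, [/\ B V, V x & V `<=` U].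
Proof.
split=> -[Bo BP]; split=> //.
  move=> U x Uo Ux; have [V [BV Vx] VU] := BP x _ (open_nbhs_nbhs (conj Uo Ux)).
  by exists V.
move=> x N; rewrite nbhsE => -[U [Uo Ux] UN]; have [V [BV Vx VU]] := BP U x Uo Ux.
by exists V => //; exact: subset_trans UN.
Qed.

(** * Contact, and bounded clusters generated by ultrafilters *)

Section BoundedCluster.
Context {d : Order.disp_t} {A : ctbDistrLatticeType d} (L : lca A).
Implicit Types (a b c e : A) (u sigma : set A).
Let rho := lca_rel L.
Let Bd := lca_bounded L.
Let rC := lca_contact L.
Let rI := lca_ideal L.

Lemma contact_le a b a' b' : (a <= a')%O -> (b <= b')%O -> rho a b -> rho a' b'.
Proof.
move=> aa bb ab; rewrite -(join_idPr bb).
apply/(contact_join rC); left; apply: (contact_sym rC).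
rewrite -(join_idPr aa); apply/(contact_join rC); left.
exact: (contact_sym rC).
Qed.

Lemma contact_meet a b : (a `&` b)%O != \bot%O -> rho a b.
Proof. by move=> /(contact_refl rC); apply: contact_le; rewrite (leIl, leIr). Qed.

Lemma well_inside_le a c : well_inside rho a c -> (a <= c)%O.
Proof.
move=> ac; rewrite -(complK c) -disj_leC; apply/negP => /negP ac0.
exact/ac/contact_meet.
Qed.

Lemma lca_C_sym a b : lca_C L a b -> lca_C L b a.
Proof. by case=> [/(contact_sym rC)|[]]; [left|right]. Qed.

(** When [lca_C] fails, one of the two elements is bounded, and (BC1) from that side gives a bounded
    interpolant; boundedness rules out the second alternative of [lca_C]. *)
Lemma lca_C_interpolate a b : ~ lca_C L a b ->
  exists c, ~ lca_C L a c /\ ~ lca_C L (~` c)%O b.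
Proof.
suff wlog_bounded x y : Bd x -> ~ rho x y ->
    exists c, ~ lca_C L x (~` c)%O /\ ~ lca_C L c y.
  move=> nab; have nrab : ~ rho a b by move=> ?; apply: nab; left.
  have [Ba|nBa] := pselect (Bd a).
    have [c [ac cb]] := wlog_bounded _ _ Ba nrab.
    by exists (~` c)%O; rewrite complK.
  have Bb : Bd b by apply: contrapT => nBb; apply: nab; right.
  have [|c [bc ca]] := wlog_bounded _ a Bb.
    by move=> /(contact_sym rC).
  by exists c; split; move=> /lca_C_sym.
move=> Bx nxy; have [|c [Bc xc cy]] := @lca_BC1 _ _ L x (~` y)%O Bx.
  by rewrite /well_inside complK.
by exists c; rewrite /well_inside complK in cy; split; case=> [|[]].
Qed.

Lemma ultra_contact u a b : ultrafilter u -> u a -> u b -> rho a b.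
Proof.
move=> uU ua ub; apply: contact_meet; apply/eqP => ab0.
by apply: (ultra_bot uU); rewrite -ab0; exact: ultra_meet.
Qed.

Lemma ultra_bounded_cluster u e : ultrafilter u -> u e -> Bd e ->
  bounded_cluster L [set a | forall b, u b -> rho a b].
Proof.
move=> uU ue Be; set sigma := [set a | _].
have u_sigma : u `<=` sigma.
  by move=> a ua b; exact: ultra_contact.
split; last by exists e; split=> //; exact: u_sigma.
split.
- by exists e; exact: u_sigma.
(* [u] contains the interpolant [c] or its complement, and either choice contradicts one half of the
   interpolation. *)
- move=> a b sa sb; apply: contrapT => /lca_C_interpolate[c [ac cb]].
  have [uc|uc] := ultra_compl uU c; first by apply: ac; left; exact: sa.
  by apply: cb; left; apply: (contact_sym rC); exact: sb.
- move=> a b sab; apply: contrapT => /not_orP[].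
  move=> /existsNP[x /not_implyP[ux nrax]] /existsNP[y /not_implyP[uy nrby]].
  have /(contact_sym rC)/(contact_join rC) := sab _ (ultra_meet uU ux uy).
  case=> /(contact_sym rC) r.
    by apply: nrax; apply: contact_le r; rewrite // leIl.
  by apply: nrby; apply: contact_le r; rewrite // leIr.
(* Meeting [b] with [e] makes it bounded, so that [lca_C] gives the contact [rho]. *)
- move=> a aC b ub; have /u_sigma/aC := ultra_meet uU ub ue.
  case=> [|[_]]; first by apply: contact_le => //; exact: leIl.
  by case; apply: (ideal_le rI _ Be); exact: leIr.
Qed.

(** * The sets [lambda a]: separation, reflection of the order, compactness *)

Lemma lambda_le a b : (a <= b)%O -> @lambda _ _ L a `<=` lambda b.
Proof. by move=> /join_idPr <-; rewrite lambda_join => s; left. Qed.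

Lemma lambda_top : @lambda _ _ L \top%O = setT.
Proof.
apply/seteqP; split=> // s _; have [[[a sa] _ _ _] _] := svalP s.
exact: (lambda_le (lex1 a)).
Qed.

Lemma lambdaC a : ~` @lambda _ _ L (~` a)%O `<=` lambda a.
Proof.
move=> s nsa; have : lambda (a `|` ~` a)%O s by rewrite joinxC lambda_top.
by rewrite lambda_join => -[].
Qed.

Lemma open_lambdaC a : open (~` @lambda _ _ L a).
Proof.
by rewrite openC; apply/closed_PsiP; exists [set a]; rewrite bigcap_set1.
Qed.

Lemma open_lambdaP (U : set (Psi L)) s : open U -> U s ->
  exists2 a, ~ lambda a s & ~` lambda a `<=` U.
Proof.
rewrite -(setCK U) openC => /closed_PsiP[S ->]; rewrite setC_bigcap => -[a Sa sa].
by exists a => // p pa; exists a.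
Qed.

Lemma lambda_disjoint a b : Bd a -> ~ rho a b -> @lambda _ _ L a `<=` ~` lambda b.
Proof.
move=> Ba nab s sa sb; have [cs _] := svalP s.
by case: (cluster_contact cs sa sb) => [|[]].
Qed.

Lemma ultra_lambda u e : ultrafilter u -> u e -> Bd e ->
  exists s : Psi L, forall a, lambda a s <-> (forall b, u b -> rho a b).
Proof. by move=> uU ue Be; exists (exist _ _ (ultra_bounded_cluster uU ue Be)). Qed.

(** If the meet of [a] and the complement of [b] is nonzero, (BC3) puts a nonzero bounded [e] well
    inside it; the cluster of an ultrafilter through [e] lies in [lambda a] but not in
    [lambda b]. *)
Lemma lambda_subset a b : @lambda _ _ L a `<=` lambda b -> (a <= b)%O.
Proof.
move=> ab; rewrite -(complK b) -disj_leC; apply/negP => /negP /(lca_BC3 L).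
move=> [e [Be e0 eab]].
have [|u uU eu] := @ultrafilter_ext _ _ [set e].
  move=> s sub /eqP; rewrite -lex0 => s0; case/eqP: e0; apply/eqP; rewrite -lex0.
  by apply: le_trans s0; apply/meetsP_seq => x xs _; rewrite (sub x xs).
have ue : u e by exact: eu.
have [s sP] := ultra_lambda uU ue Be.
have se : lambda e s by apply/sP => b0; exact: ultra_contact.
have := lambda_disjoint Be eab se.
rewrite complI complK lambda_join => /not_orP[nsa nsb]; apply: nsb; apply: ab.
by apply: lambdaC.
Qed.

(* If no finite part of [F] covers [lambda a], then [a] and the complements of
   the elements [x] with [lambda x] inside a member of [F] generate a proper
   filter; the cluster of an ultrafilter extending it is not covered. *)
Lemma compact_lambda a (F : set (set (Psi L))) : Bd a -> F `<=` open ->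
  lambda a `<=` \bigcup_(U in F) U ->
  exists2 s : seq (set (Psi L)), [set` s] `<=` F &
    lambda a `<=` \bigcup_(U in [set` s]) U.
Proof.
move=> Ba Fo aF; apply: contrapT => nfin.
pose G := [set x | exists2 U, F U & lambda (~` x)%O `<=` U].
have [|u uU aGu] := @ultrafilter_ext _ _ (a |` G).
  move=> s sub s0; apply: nfin.
  (* Generalized for induction on [s]: members equal to [a] contribute nothing and members of [G]
     contribute one set of [F]. A zero meet gives back [lambda a]. *)
  suff [r rF ar] : exists2 r : seq (set (Psi L)), [set` r] `<=` F &
      lambda (a `&` ~` \meet_(x <- s) x)%O `<=` \bigcup_(U in [set` r]) U.
    by exists r => //; move: ar; rewrite s0 compl0 meetx1.
  elim: s sub {s0} => [|x s IHs] sub.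
    by exists [::] => //; rewrite big_nil compl1 meetx0 lambda_bot.
  have [|r rF ar] := IHs; first by move=> y ys; apply: sub; rewrite /= inE ys orbT.
  rewrite big_cons complI meetUr lambda_join.
  case: (sub x) => [|->|[U FU xU]]; first by rewrite /= mem_head.
    by exists r => //; rewrite meetxC lambda_bot set0U.
  exists (U :: r); first by move=> V /=; rewrite inE => /predU1P[->//|/rF].
  move=> p [/(lambda_le (leIr _ _))/xU Up|/ar[V rV Vp]].
    by exists U => //=; rewrite mem_head.
  by exists V => //=; rewrite inE; apply/orP; right.
have ua : u a by apply: aGu; left.
have [s sP] := ultra_lambda uU ua Ba.
have sa : lambda a s by apply/sP => b; exact: ultra_contact.
have [U FU Us] := aF _ sa; have [c /sP nsc cU] := open_lambdaP (Fo _ FU) Us.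
have /existsNP[x /not_implyP[ux ncx]] := nsc.
(* The bounded element [a]&[x] is not in contact with [c], so its [lambda] lies inside [U] and its
   complement belongs to [G], although it is itself in [u]. *)
apply: (ultra_bot uU); rewrite -(meetxC (a `&` x)%O).
apply: (ultra_meet uU); first exact: (ultra_meet uU).
apply: aGu; right; exists U => //; rewrite complK; apply: subset_trans cU.
apply: lambda_disjoint; first exact: (ideal_le rI (leIl _ _) Ba).
by move=> /(contact_sym rC) cx; apply: ncx; apply: contact_le cx; rewrite // leIr.
Qed.

(** * Passage between bases of the algebra and bases of the space *)

Lemma lca_base_basis (B : set A) : lca_base L B ->
  basis [set ~` @lambda _ _ L (~` b)%O | b in B].
Proof.
move=> [BBd Bint]; apply/basisE; split=> [_ [b _ <-]|U s Uo Us].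
  exact: open_lambdaC.
have [v nsv vU] := open_lambdaP Uo Us; have [cs [e [se Be]]] := svalP s.
have [f sf nvf] : exists2 f, lambda f s & ~ lca_C L v f.
  apply: contrapT => nex; apply/nsv/(cluster_max cs) => f sf.
  by apply: contrapT => nvf; apply: nex; exists f.
have [g [vg gf]] := lca_C_interpolate nvf.
(* [g] separates [s] from [v] but may be unbounded; meeting it with a bounded [k] around [e] gives a
   bounded element well inside the complement of [v], from which an element of [B] can be
   inserted. *)
have [|k [Bk ek _]] := @lca_BC1 _ _ L e \top%O Be.
  rewrite /well_inside compl1 => /(contact_neq0 rC)[_]; by rewrite eqxx.
have nsh : ~ lambda (~` (g `&` k))%O s.
  rewrite complI lambda_join => -[sg|sk].
    by apply: gf; exact: (cluster_contact cs).
  exact: (lambda_disjoint Be ek se).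
have [||c [Bc hc cv]] := @lca_BC1 _ _ L (g `&` k)%O (~` v)%O.
- exact: (ideal_le rI (leIr _ _) Bk).
- rewrite /well_inside complK => /(contact_sym rC) gv; apply: vg; left.
  by apply: contact_le gv; rewrite // leIl.
have [b [bB hb bc]] := Bint _ _ (ideal_le rI (leIr _ _) Bk) Bc hc.
exists (~` lambda (~` b)%O); split; first by exists b.
  by move=> sb; apply: nsh; apply: lambda_le sb; rewrite leC.
apply: subset_trans vU => p npb pv; apply: npb; apply: lambda_le pv.
rewrite lexC; apply: le_trans bc _; exact: well_inside_le.
Qed.

(** Compactness is applied to the members of [B] contained in [U], which keeps the finite union
    inside [U]. *)
Lemma basis_cover (B : set (set (Psi L))) a (U : set (Psi L)) :
  basis B -> Bd a -> open U -> lambda a `<=` U ->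
  exists2 s : seq (set (Psi L)), [set` s] `<=` B &
    lambda a `<=` \bigcup_(V in [set` s]) V /\ \bigcup_(V in [set` s]) V `<=` U.
Proof.
move=> /basisE[Bo BP] Ba Uo aU.
have [||s sBU as_] := @compact_lambda a [set V | B V /\ V `<=` U] Ba.
- by move=> V [/Bo].
- by move=> p /aU/(BP U p Uo)[V [BV Vp VU]]; exists V.
exists s; first by move=> V /sBU[].
by split=> // p [V /sBU[_ VU] /VU].
Qed.

(** The bound is restricted to infinite [B'] because a finite basis may have more pairs of finite
    unions than members. *)
Lemma basis_lca_base (B : set (set (Psi L))) : basis B ->
  exists2 B', lca_base L B' & infinite_set B' -> (B' #<= B)%card.
Proof.
move=> Bb.
pose between (VW : set (Psi L) * set (Psi L)) b :=
  [/\ Bd b, VW.1 `<=` lambda b & lambda b `<=` VW.2].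
have /choice[pick pickP] (VW : set (Psi L) * set (Psi L)) :
    exists b, (exists c, between VW c) -> between VW b.
  have [[b bP]|nex] := pselect (exists c, between VW c); first by exists b.
  (* A default for pairs with nothing in between; such pairs are left out of the image below. *)
  by exists \bot%O.
exists (pick @` [set VW | (finite_unions B `*` finite_unions B) VW /\
    exists b, between VW b]); last first.
  set E := [set VW | _]; have EB : E `<=` finite_unions B `*` finite_unions B.
    by move=> ? [].
  move=> infE; have infB : infinite_set B.
    move=> /finite_finite_unions finB; apply: infE; apply: finite_image.
    exact: sub_finite_set EB (finite_setX _ _).
  apply: card_le_trans (card_image_le _ _) _.
  exact: card_le_trans (subset_card_le EB) (card_finite_unionsX infB).
split=> [_ [VW [_ /pickP[]] ? _ _ <-] //|a c Ba Bc ac].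
have [b [Bb' ab bc]] := lca_BC1 Ba ac.
have [s sB [as_ sb]] := basis_cover Bb Ba (open_lambdaC _) (lambda_disjoint Ba ab).
have [t tB [bt tc]] := basis_cover Bb Bb' (open_lambdaC _) (lambda_disjoint Bb' bc).
set V := \bigcup_(_ in _) _ in as_ sb; set W := \bigcup_(_ in _) _ in bt tc.
have bVW : between (V, W) b.
  by split=> //=; exact: subset_trans (@lambdaC b).
have [_ /= Vp pW] := pickP (V, W) (ex_intro _ b bVW).
exists (pick (V, W)); split.
- exists (V, W) => //; split; last by exists b.
  by split; [exists s|exists t].
- by apply: lambda_subset; exact: subset_trans Vp.
- apply: lambda_subset; apply: subset_trans pW (subset_trans tc _); exact: lambdaC.
Qed.

End BoundedCluster.

Theorem proposition3p3 (T : Type) (tau : set T) (tau_infinite : infinite_set tau)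
    (d : Order.disp_t) (A : ctbDistrLatticeType d) (L : lca A) :
  weight_is (Psi L) tau <-> lca_weight_is L tau.
Proof.
split=> -[[B [BP Btau]] tau_le].
  have lca_tau_le B' : lca_base L B' -> (tau #<= B')%card.
    by move=> /lca_base_basis/tau_le/card_le_trans; apply; exact: card_image_le.
  split=> //; have [B' B'P B'B] := basis_lca_base BP; exists B'; split=> //.
  have tauB' := lca_tau_le _ B'P; apply: Cantor_Bernstein => //.
  move: Btau; rewrite card_eq_le => /andP[Btau _].
  apply: card_le_trans (B'B _) Btau.
  (* [B'] dominates the infinite [tau], so it is infinite and the bound by [B] is available. *)
  by move=> /(card_le_finite tauB').
have basis_tau_le (C : set (set (Psi L))) : basis C -> (tau #<= C)%card.
  move=> /basis_lca_base[B' /tau_le tauB' B'C];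
  apply: (card_le_trans tauB' (B'C _)).
  by move=> /(card_le_finite tauB').
split=> //; have Bb := lca_base_basis BP; eexists; split; first exact: Bb.
apply: Cantor_Bernstein; last exact: basis_tau_le.
move: Btau; rewrite card_eq_le => /andP[Btau _].
exact: card_le_trans (card_image_le _ _) Btau.
Qed.
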